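(* Let $A \in M_{2m}(\mathbb{C})$ be $J_{2m}$-normal and diagonalizable. Then there exists some symplectic matrix $S \in GL_{2m}(\mathbb{C})$ such that $S^{-1}AS$ is a matrix in four-diagonal-form.
   Context: $M_{k}(\mathbb{C})$ is the set of complex $k\times k$ matrices, $GL_{k}(\mathbb{C})$ the nonsingular ones, and $^H$ denotes conjugate transpose. $J_{2m} = \begin{bmatrix} 0 & I_m \\ -I_m & 0\end{bmatrix}$. For $A\in M_{2m}(\mathbb{C})$ put $A^\star := J_{2m}^{-1}A^HJ_{2m}$. $A$ is $J_{2m}$-normal if $AA^\star=A^\star A$. $S$ is symplectic if $S^HJ_{2m}S=J_{2m}$. Diagonalizable means similar over $\mathbb{C}$ to a diagonal matrix. A matrix in $M_{2m}(\mathbb{C})$ is in four-diagonal-form if it equals $\begin{bmatrix} D_{11}&D_{12}\\ D_{21}&D_{22}\end{bmatrix}$ with diagonal matrices $D_{11},D_{12},D_{21},D_{22}\in M_m(\mathbb{C})$. *)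

(* Defs.v *)
From mathcomp Require Import all_boot all_order all_algebra.
From mathcomp Require Export reals complex.

Set Implicit Arguments.
Unset Strict Implicit.
Unset Printing Implicit Defensive.

Import GRing.Theory Num.Theory.
Local Open Scope ring_scope.
Local Open Scope sesquilinear_scope.

(* Matrices of size 2m are indexed by m + m, so that block_mx applies.
   M ^t* is the conjugate transpose. *)

Definition Jmx {C : numClosedFieldType} (m : nat) : 'M[C]_(m + m) :=
  block_mx 0 1%:M (- 1%:M) 0.

Definition Jstar {C : numClosedFieldType} {m : nat} (A : 'M[C]_(m + m)) :
    'M[C]_(m + m) :=
  invmx (Jmx m) *m A ^t* *m Jmx m.

Definition Jnormal {C : numClosedFieldType} {m : nat} (A : 'M[C]_(m + m)) :
    Prop :=
  A *m Jstar A = Jstar A *m A.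

(* Symplectic with respect to the sesquilinear form of J, that is, with the
   conjugate transpose of S rather than its transpose. *)
Definition symplectic {C : numClosedFieldType} {m : nat} (S : 'M[C]_(m + m)) :
    Prop :=
  S ^t* *m Jmx m *m S = Jmx m.

Definition four_diagonal_form {C : numClosedFieldType} {m : nat}
    (A : 'M[C]_(m + m)) : Prop :=
  exists D11 D12 D21 D22 : 'M[C]_m,
    [/\ is_diag_mx D11, is_diag_mx D12, is_diag_mx D21 & is_diag_mx D22]
    /\ A = block_mx D11 D12 D21 D22.

(* Jmx is invertible, so the invmx in Jstar is the genuine inverse. *)
Lemma Jmx_unit (C : numClosedFieldType) (m : nat) :
  Jmx m \in @unitmx C (m + m).
Proof.
have JJ : Jmx m *m - Jmx m = 1%:M :> 'M[C]_(m + m).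
  rewrite mulmxN /Jmx mulmx_block !mul0mx !mulmx0 !mul1mx !mulmx1.
  by rewrite !add0r !addr0 opp_block_mx !opprK !oppr0 -scalar_mx_block.
by case/mulmx1_unit: JJ.
Qed.

(* Main.v *)
Require Import Defs.
From mathcomp Require Import all_boot all_order all_algebra.
From mathcomp Require Import reals complex.
From mathcomp Require Import ring.

(** Write vectors as rows and put <x, y> = x J y^H.  This form is nondegenerate
    and skew-Hermitian.  The matrix S is symplectic when the rows of S^H are
    u_1..u_m, v_1..v_m with <u_i, u_j> = <v_i, v_j> = 0 and <u_i, v_j> = 1 or 0
    according as i = j or not; and S^-1 A S is in four-diagonal-form as soon as
    each plane spanned by u_i and v_i is stable under x |-> x A^H.  So the space
    has to be split into m mutually orthogonal hyperbolic planes stable under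
    A^H.

    J-normality says that A^H commutes with its adjoint B for the form.  Both
    are diagonalizable, hence there is a basis of common eigenvectors.  Common
    eigenvectors with eigenvalues (a, b) are orthogonal to those with
    eigenvalues (c, d) unless a = conj d and b = conj c
    (common_eigvec_gram_neq0); so two of them that are not isotropic are
    orthogonal unless they have the same eigenvalues.

    The planes are split off one at a time (adapted_frame_extend).  Suppose that
    k < m have been found.  The projection onto the orthogonal complement W of
    their sum commutes with A^H and B (orth_proj_comm), so W is spanned by
    common eigenvectors.  For e = 'i and for e = - 'i the function e <w, w> is
    real-valued, and W contains a nonzero w at which it is nonpositive: there is
    an isotropic subspace of dimension m, and in it a vector whose component in
    the sum of the k planes lies in a positive definite part, so that w, the
    component in W, makes up for it (isotropic_nonpos).  Grouping the
    eigencomponents of w by eigenvalues gives a common eigenvector in W at which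
    e <w, w> is nonpositive (common_eigvec_nonpos).  If one of the two common
    eigenvectors so obtained is isotropic, pair it with a common eigenvector of
    W that is not orthogonal to it; otherwise the two of them have values of
    opposite signs.  In either case the two common eigenvectors have a Gram
    matrix of positive determinant, and the plane that they span is hyperbolic
    (plane_gram_hyperbolic).  It is stable because it is spanned by
    eigenvectors. *)

Set Implicit Arguments.
Unset Strict Implicit.
Unset Printing Implicit Defensive.

Import Order.TTheory GRing.Theory Num.Theory.
Local Open Scope ring_scope.
Local Open Scope sesquilinear_scope.

(** * Conjugate transposes *)

Section ConjugateTranspose.
Variable C : numClosedFieldType.

Lemma ctr_mul m n p (X : 'M[C]_(m, n)) (Y : 'M[C]_(n, p)) :
  (X *m Y) ^t* = Y ^t* *m X ^t*.
Proof. by rewrite trmx_mul map_mxM. Qed.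

Lemma ctrD m n (X Y : 'M[C]_(m, n)) : (X + Y) ^t* = X ^t* + Y ^t*.
Proof. by rewrite linearD map_mxD. Qed.

Lemma ctrN m n (X : 'M[C]_(m, n)) : (- X) ^t* = - X ^t*.
Proof. by rewrite linearN map_mxN. Qed.

Lemma ctrZ m n a (X : 'M[C]_(m, n)) : (a *: X) ^t* = a^* *: X ^t*.
Proof. by rewrite linearZ map_mxZ. Qed.

Lemma ctr_diag n (d : 'rV[C]_n) : (diag_mx d) ^t* = diag_mx (map_mx Num.conj d).
Proof. by rewrite tr_diag_mx map_diag_mx. Qed.

Lemma ctr_unit n (X : 'M[C]_n) : (X ^t* \in unitmx) = (X \in unitmx).
Proof. by rewrite map_unitmx unitmx_tr. Qed.

Lemma ctr_inv n (X : 'M[C]_n) : (invmx X) ^t* = invmx (X ^t*).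
Proof. by rewrite trmx_inv map_invmx. Qed.

End ConjugateTranspose.

(** * Gram matrices of a sesquilinear form *)

Section Gram.
Variables (C : numClosedFieldType) (n : nat) (H : 'M[C]_n).

Definition gram p q (X : 'M[C]_(p, n)) (Y : 'M[C]_(q, n)) : 'M[C]_(p, q) :=
  X *m H *m Y ^t*.

Lemma gramE p q (X : 'M_(p, n)) (Y : 'M_(q, n)) :
  gram X Y = X *m H *m Y ^t*.
Proof. by []. Qed.

Lemma gramDl p q (X X' : 'M_(p, n)) (Y : 'M_(q, n)) :
  gram (X + X') Y = gram X Y + gram X' Y.
Proof. by rewrite /gram !mulmxDl. Qed.

Lemma gramDr p q (X : 'M_(p, n)) (Y Y' : 'M_(q, n)) :
  gram X (Y + Y') = gram X Y + gram X Y'.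
Proof. by rewrite /gram ctrD mulmxDr. Qed.

Lemma gramZl p q a (X : 'M_(p, n)) (Y : 'M_(q, n)) :
  gram (a *: X) Y = a *: gram X Y.
Proof. by rewrite /gram -!scalemxAl. Qed.

Lemma gramZr p q a (X : 'M_(p, n)) (Y : 'M_(q, n)) :
  gram X (a *: Y) = a^* *: gram X Y.
Proof. by rewrite /gram ctrZ -scalemxAr. Qed.

Lemma gramMl p p' q (M : 'M_(p', p)) (X : 'M_(p, n)) (Y : 'M_(q, n)) :
  gram (M *m X) Y = M *m gram X Y.
Proof. by rewrite /gram !mulmxA. Qed.

Lemma gramMr p q q' (M : 'M_(q', q)) (X : 'M_(p, n)) (Y : 'M_(q, n)) :
  gram X (M *m Y) = gram X Y *m M ^t*.
Proof. by rewrite /gram ctr_mul !mulmxA. Qed.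

Lemma gram0l p q (Y : 'M_(q, n)) : gram (0 : 'M_(p, n)) Y = 0.
Proof. by rewrite /gram !mul0mx. Qed.

Lemma gram_suml (I : Type) (r : seq I) (P : pred I) p q (F : I -> 'M_(p, n))
    (Y : 'M_(q, n)) :
  gram (\sum_(i <- r | P i) F i) Y = \sum_(i <- r | P i) gram (F i) Y.
Proof. by rewrite /gram !mulmx_suml. Qed.

Lemma gram_sumr (I : Type) (r : seq I) (P : pred I) p q (X : 'M_(p, n))
    (F : I -> 'M_(q, n)) :
  gram X (\sum_(i <- r | P i) F i) = \sum_(i <- r | P i) gram X (F i).
Proof. by rewrite /gram raddf_sum /= map_mx_sum mulmx_sumr. Qed.

Lemma gram0r p q (X : 'M_(p, n)) : gram X (0 : 'M_(q, n)) = 0.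
Proof. by rewrite /gram trmx0 map_mx0 mulmx0. Qed.

Lemma gram_col_mxl p p' q (X : 'M_(p, n)) (X' : 'M_(p', n)) (Y : 'M_(q, n)) :
  gram (col_mx X X') Y = col_mx (gram X Y) (gram X' Y).
Proof. by rewrite /gram !mul_col_mx. Qed.

Lemma gram_col_mxr p q q' (X : 'M_(p, n)) (Y : 'M_(q, n)) (Y' : 'M_(q', n)) :
  gram X (col_mx Y Y') = row_mx (gram X Y) (gram X Y').
Proof. by rewrite /gram tr_col_mx map_row_mx mul_mx_row. Qed.

Lemma gram_col_mx p q p' q' (X : 'M_(p, n)) (X' : 'M_(p', n))
    (Y : 'M_(q, n)) (Y' : 'M_(q', n)) :
  gram (col_mx X X') (col_mx Y Y') =
  block_mx (gram X Y) (gram X Y') (gram X' Y) (gram X' Y').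
Proof. by rewrite gram_col_mxl !gram_col_mxr. Qed.

Lemma row_gram p q (X : 'M_(p, n)) (Y : 'M_(q, n)) i j :
  gram (row i X) (row j Y) = (gram X Y i j)%:M.
Proof.
apply/rowP=> l; rewrite !ord1 /gram tr_row map_col -row_mul -row_mul.
by rewrite colE mulmxA -colE !mxE eqxx mulr1n.
Qed.

Hypothesis H_skew : H ^t* = - H.

Lemma gramC p q (X : 'M_(p, n)) (Y : 'M_(q, n)) : gram X Y = - (gram Y X) ^t*.
Proof. by rewrite /gram !ctr_mul trmxCK H_skew mulNmx mulmxN opprK mulmxA. Qed.

Lemma gram_diag_conj (x : 'rV_n) : (gram x x 0 0)^* = - gram x x 0 0.
Proof. by rewrite [in RHS]gramC !mxE opprK. Qed.

Hypothesis H_unit : H \in unitmx.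

(** A vector y with <u, y> = 1 exists by nondegeneracy; subtracting a multiple
    of u keeps <u, y> and can cancel <y, y>, which is purely imaginary. *)
Lemma isotropic_partner (u : 'rV_n) : u != 0 -> gram u u = 0 ->
  exists v : 'rV_n, gram u v = 1%:M /\ gram v v = 0.
Proof.
move=> u0 uu.
have /rV0Pn[j rj] : u *m H != 0.
  by apply: contraNneq u0 => uH; rewrite -(mulmxK H_unit u) uH mul0mx.
pose y : 'rV_n := (((u *m H) 0 j)^-1)^* *: delta_mx 0 j.
have uy : gram u y = 1%:M.
  rewrite gramZr conjCK /gram trmx_delta map_delta_mx -colE.
  apply/rowP=> i; rewrite !ord1; move: rj; rewrite !mxE => rj.
  by rewrite mulVf.
clearbody y; have yu : gram y u = - 1%:M by rewrite gramC uy trmx1 map_mx1.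
have [c yy] : exists c : C, gram y y = c%:M.
  by exists (gram y y 0 0); exact: mx11_scalar.
have cc : c^* = - c by have := gram_diag_conj y; rewrite yy !mxE !mulr1n.
exists (y - (c / 2) *: u); rewrite -scaleNr; split.
  by rewrite gramDr gramZr uu scaler0 addr0.
rewrite !(gramDl, gramDr, gramZl, gramZr) uu uy yu yy rmorphN fmorph_div.
rewrite /= cc rmorph_nat.
by apply/rowP=> i; rewrite !ord1 !mxE !mulr1n /=; field.
Qed.

End Gram.

(** * Indefinite planes are hyperbolic *)

Section Plane.
Variable C : numClosedFieldType.

(** For imaginary p and q this is the general skew-Hermitian 2 x 2 matrix; its
    determinant is p * q + r * r^*. *)
Definition plane_gram (p q r : C) : 'M[C]_(1 + 1) :=
  block_mx p%:M r%:M (- r^*)%:M q%:M.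

Lemma plane_gram_unit p q r :
  p * q + r * r^* != 0 -> plane_gram p q r \in unitmx.
Proof.
move=> d0; set d := p * q + r * r^* in d0.
have /mulmx1_unit[] // : plane_gram p q r *m
    (d^-1 *: block_mx q%:M (- r)%:M r^*%:M p%:M) = 1%:M.
rewrite -scalemxAr mulmx_block -!scalar_mxM -!raddfD /=.
have -> : p * q + r * r^* = d by [].
have -> : p * - r + r * p = 0 by ring.
have -> : - r^* * q + q * r^* = 0 by ring.
have -> : - r^* * - r + q * p = d by rewrite /d; ring.
by rewrite raddf0 -scalar_mx_block scale_scalar_mx mulVf.
Qed.

(** The form is p |x|^2 + q |y|^2 plus cross terms.  Completing the square shows
    that it is isotropic when the determinant d is positive: at y = p it vanishes
    for x = sqrt d + r^*. *)
Lemma plane_gram_isotropic p q r :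
  p^* = - p -> q^* = - q -> 0 < p * q + r * r^* ->
  exists2 u : 'rV_(1 + 1), u != 0 & gram (plane_gram p q r) u u = 0.
Proof.
move=> pC qC d_gt0.
have gram_row x y :
  gram (plane_gram p q r) (row_mx x%:M y%:M) (row_mx x%:M y%:M) =
  (x * p * x^* - y * r^* * x^* + x * r * y^* + y * q * y^*)%:M.
  rewrite /gram mul_row_block tr_row_mx map_col_mx mul_row_col !tr_scalar_mx.
  rewrite !map_scalar_mx /= -!scalar_mxM -!raddfD /= -!scalar_mxM.
  by rewrite -raddfD /=; congr (_%:M); ring.
have row_neq0 x y : (x != 0) || (y != 0) ->
    row_mx x%:M y%:M != 0 :> 'rV[C]_(1 + 1).
  apply: contraTneq; rewrite -row_mx0.
  move=> /eq_row_mx[/matrixP/(_ 0 0) + /matrixP/(_ 0 0)].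
  by rewrite !mxE !mulr1n => -> ->; rewrite eqxx.
have [p0|p0] := eqVneq p 0.
  exists (row_mx 1%:M 0%:M); first by rewrite row_neq0 ?oner_eq0.
  by rewrite gram_row p0 !(mulr0, mul0r, rmorph0, addr0, subr0).
set t := sqrtC (p * q + r * r^*).
have tC : t^* = t by rewrite conj_Creal // ger0_real // sqrtC_ge0 ltW.
have tt : t ^+ 2 = p * q + r * r^* by rewrite sqrtCK.
exists (row_mx (t + r^*)%:M p%:M); first by rewrite row_neq0 ?p0 ?orbT.
have xC : (t + r^*)^* = t + r by rewrite rmorphD /= conjCK tC.
rewrite gram_row xC pC.
set x := (X in X%:M); have -> : x = p * (t ^+ 2 - p * q - r * r^*).
  by rewrite /x; ring.
by rewrite tt [_ + _ - p * q]addrAC subrr add0r subrr mulr0 rmorph0.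
Qed.

Lemma plane_gram_hyperbolic p q r :
  p^* = - p -> q^* = - q -> 0 < p * q + r * r^* ->
  exists M : 'M_(1 + 1), M *m plane_gram p q r *m M ^t* = Jmx 1.
Proof.
move=> pC qC d_gt0; have [u u0 uu] := plane_gram_isotropic pC qC d_gt0.
have G_skew : (plane_gram p q r) ^t* = - plane_gram p q r.
  rewrite /plane_gram tr_block_mx map_block_mx opp_block_mx !tr_scalar_mx.
  have rC : (- r^*)^* = - r by rewrite rmorphN /= conjCK.
  rewrite !map_scalar_mx /= pC qC rC.
  by rewrite !(raddfN (@scalar_mx C 1)) /= opprK.
have G_unit := plane_gram_unit (lt0r_neq0 d_gt0).
have [v [uv vv]] := isotropic_partner G_skew G_unit u0 uu.
exists (col_mx u v); rewrite -/(gram _ _ _) gram_col_mx uu uv vv.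
by rewrite (gramC G_skew) uv trmx1 map_mx1.
Qed.

End Plane.

(** * Hyperbolic frames *)

Section Frames.
Variables (C : numClosedFieldType) (n : nat) (H : 'M[C]_n).
Hypothesis H_skew : H ^t* = - H.
Local Notation gram := (gram H).

Definition hyperbolic_frame k (U V : 'M[C]_(k, n)) :=
  [/\ gram U U = 0, gram U V = 1%:M & gram V V = 0].

Definition frame_plane k (U V : 'M[C]_(k, n)) i : 'M_(1 + 1, n) :=
  col_mx (row i U) (row i V).

Lemma hyperbolic_frame_gram k (U V : 'M_(k, n)) :
  hyperbolic_frame U V -> gram (col_mx U V) (col_mx U V) = Jmx k.
Proof.
case=> UU UV VV.
by rewrite gram_col_mx (gramC H_skew V U) UU UV VV trmx1 map_mx1.
Qed.

Lemma hyperbolic_frame_cat k l (U V : 'M_(k, n)) (U' V' : 'M_(l, n)) :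
  hyperbolic_frame U V -> hyperbolic_frame U' V' ->
  gram (col_mx U V) (col_mx U' V') = 0 ->
  hyperbolic_frame (col_mx U U') (col_mx V V').
Proof.
move=> [UU UV VV] [UU' UV' VV']; rewrite gram_col_mx -block_mx0.
case/eq_block_mx=> u0 u1 v0 v1; rewrite /hyperbolic_frame !gram_col_mx.
have swap p q (X : 'M_(p, n)) (Y : 'M_(q, n)) : gram X Y = 0 -> gram Y X = 0.
  by move=> XY; rewrite (gramC H_skew) XY trmx0 map_mx0 oppr0.
rewrite UU UV VV UU' UV' VV' u0 u1 v1 (swap _ _ _ _ u0) (swap _ _ _ _ v0).
by rewrite (swap _ _ _ _ v1) !block_mx0 -scalar_mx_block.
Qed.

Lemma frame_plane_stable k (U V : 'M_(k, n)) X :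
  (forall i, stablemx (frame_plane U V i) X) -> stablemx (col_mx U V) X.
Proof.
move=> stX; rewrite mul_col_mx col_mx_sub.
suff st i : (row i U *m X <= col_mx U V)%MS && (row i V *m X <= col_mx U V)%MS.
  by apply/andP; split; apply/row_subP=> i; rewrite row_mul; case/andP: (st i).
rewrite -col_mx_sub -mul_col_mx; apply: submx_trans (stX i) _.
have /andP[sU sV] : (U <= col_mx U V)%MS && (V <= col_mx U V)%MS.
  by rewrite -col_mx_sub.
by rewrite col_mx_sub; apply/andP; split; apply: submx_trans (row_sub i _) _.
Qed.

Lemma frame_plane_cat k l (U V : 'M_(k, n)) (U' V' : 'M_(l, n)) X :
  (forall i, stablemx (frame_plane U V i) X) ->
  (forall i, stablemx (frame_plane U' V' i) X) ->
  forall i, stablemx (frame_plane (col_mx U U') (col_mx V V') i) X.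
Proof.
move=> st st' i; rewrite /frame_plane -(splitK i).
by case: (split i) => j /=; rewrite ?rowKu ?rowKd; [exact: st | exact: st'].
Qed.

(** Row i of U *m A and of V *m A is a combination of row i of U and row i of V,
    which keeps the only nonzero entries on the diagonal. *)
Lemma frame_plane_diag k (U V Y : 'M_(k, n)) A :
    (forall i, stablemx (frame_plane U V i) A) ->
    is_diag_mx (gram U Y) -> is_diag_mx (gram V Y) ->
  is_diag_mx (gram (U *m A) Y) /\ is_diag_mx (gram (V *m A) Y).
Proof.
move=> stA /is_diag_mxP UY /is_diag_mxP VY.
have diag W : (forall i, row i W *m A <= frame_plane U V i)%MS ->
    is_diag_mx (gram (W *m A) Y).
  move=> Wst; apply/is_diag_mxP=> i j ij.
  have /submxP[X WX] := Wst i.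
  have := row_gram H (W *m A) Y i j.
  rewrite row_mul WX (gramMl H X) /frame_plane gram_col_mxl !row_gram.
  rewrite UY // VY // !raddf0 col_mx0 mulmx0.
  by move/matrixP/(_ 0 0); rewrite !mxE mulr1n.
have st i : (row i U *m A <= frame_plane U V i)%MS &&
            (row i V *m A <= frame_plane U V i)%MS.
  by rewrite -col_mx_sub -mul_col_mx; exact: stA.
by split; apply: diag => i; case/andP: (st i).
Qed.

(** On the row space of R = U + e V, of dimension k, the form e <., .> is
    positive definite.  Being orthogonal to U - e V imposes k conditions, so some
    nonzero x in the row space of L satisfies them, and its component in the span
    of U and V is then a *m R.  The rest w = x - a *m R has
    e <w, w> = - e <a *m R, a *m R> because x is isotropic, and w = 0 would force
    a = 0. *)
Lemma isotropic_nonpos m (L : 'M_(m, n)) k (U V : 'M_(k, n)) (e : C) :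
    row_free L -> gram L L = 0 -> hyperbolic_frame U V -> (k < m)%N ->
    e^* = - e -> e ^+ 2 = -1 ->
  exists2 w : 'rV_n, w != 0 & gram w (col_mx U V) = 0 /\ e * gram w w 0 0 <= 0.
Proof.
move=> L_free LL [UU UV VV] km eC ee.
have VU : gram V U = - 1%:M by rewrite (gramC H_skew) UV trmx1 map_mx1.
have /rowV0Pn[z zK z0] : kermx (gram L (U - e *: V)) != 0.
  rewrite kermx_eq0 /row_free; apply: contraTneq km => <-.
  by rewrite -leqNgt rank_leq_col.
pose x := z *m L; pose a := gram x V; pose R := U + e *: V.
have x0 : x != 0 by rewrite mulmx_free_eq0.
have xx : gram x x = 0 by rewrite gramMl gramMr LL mul0mx mulmx0.
have xU : gram x U = - e *: a.
  move: zK => /sub_kermxP; rewrite -gramMl -scaleNr gramDr gramZr rmorphN /=.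
  by rewrite eC opprK => /eqP; rewrite addr_eq0 => /eqP->; rewrite scaleNr.
clearbody x.
have RU : gram R U = (- e)%:M.
  by rewrite gramDl gramZl UU VU add0r scalerN scalemx1 -raddfN.
have RV : gram R V = 1%:M by rewrite gramDl gramZl UV VV scaler0 addr0.
pose w := x - a *m R.
have wU : gram w U = 0.
  rewrite gramDl -mulNmx gramMl RU xU mul_mx_scalar.
  by rewrite scalerN scaleNr opprK addNr.
have wV : gram w V = 0 by rewrite gramDl -mulNmx gramMl RV mulmx1 subrr.
have wR : gram w R = 0 by rewrite gramDr gramZr wU wV scaler0 addr0.
have xR : gram x R = - (2 * e) *: a.
  by rewrite gramDr gramZr xU eC -scalerDl; congr (_ *: _); ring.
have ww : gram w w = (2 * e) *: (a *m a ^t*).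
  have -> : gram w w = gram w x.
    by rewrite {2}/w gramDr -mulNmx gramMr wR mul0mx addr0.
  rewrite gramDl xx add0r -mulNmx gramMl (gramC H_skew) xR ctrZ.
  rewrite rmorphN rmorphM /= eC rmorph_nat mulNmx mulmxN opprK -scalemxAr.
  by rewrite mulrN opprK.
pose S := \sum_j a 0 j * (a 0 j)^*.
have S_ge0 : 0 <= S by apply: sumr_ge0 => j _; apply: mul_conjC_ge0.
have wwS : gram w w 0 0 = 2 * e * S.
  by rewrite ww 2!mxE; congr (_ * _); apply: eq_bigr => j _; rewrite !mxE.
exists w; last first.
  split; first by rewrite gram_col_mxr wU wV row_mx0.
  rewrite wwS (_ : e * _ = e ^+ 2 * (2 * S)); last by ring.
  by rewrite ee mulN1r oppr_le0 mulr_ge0.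
apply: contraNneq x0 => w0; suff a0 : a = 0.
  by rewrite -(subrK (a *m R) x) -/w w0 a0 mul0mx addr0.
have e0 : e != 0.
  by apply: contra_eq_neq ee => ->; rewrite expr0n eq_sym oppr_eq0 oner_eq0.
have /eqP : 2 * e * S = 0 by rewrite -wwS w0 gram0l mxE.
rewrite !mulf_eq0 pnatr_eq0 (negPf e0) /= => /eqP/psumr_eq0P aa.
apply/rowP=> j; rewrite [RHS]mxE; apply/eqP; rewrite -mul_conjC_eq0.
by apply/eqP/aa => // l _; apply: mul_conjC_ge0.
Qed.

End Frames.

(** * Common eigenvectors of an operator and its adjoint *)

Section CommonEigenvectors.
Variables (C : numClosedFieldType) (n : nat) (H A B : 'M[C]_n).
Hypothesis H_skew : H ^t* = - H.
Hypothesis adjAB : A *m H = H *m B ^t*.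
Local Notation gram := (gram H).

Lemma gram_adjA p q (X : 'M_(p, n)) (Y : 'M_(q, n)) :
  gram (X *m A) Y = gram X (Y *m B).
Proof. by rewrite !gramE ctr_mul -!mulmxA (mulmxA A) adjAB !mulmxA. Qed.

Lemma gram_adjB p q (X : 'M_(p, n)) (Y : 'M_(q, n)) :
  gram (X *m B) Y = gram X (Y *m A).
Proof. by rewrite (gramC H_skew) -gram_adjA -(gramC H_skew). Qed.

Definition common_eigvec (c : C * C) (x : 'rV[C]_n) :=
  x *m A = c.1 *: x /\ x *m B = c.2 *: x.

Lemma common_eigvec_sum (I : finType) (P : pred I) (c : C * C) w :
  (forall i, P i -> common_eigvec c (w i)) ->
  common_eigvec c (\sum_(i | P i) w i).
Proof.
by move=> cw; split; rewrite mulmx_suml scaler_sumr;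
  apply: eq_bigr => i /cw[].
Qed.

Lemma common_eigvecZ c a x : common_eigvec c x -> common_eigvec c (a *: x).
Proof. by case=> xA xB; split; rewrite -scalemxAl ?xA ?xB !scalerA mulrC. Qed.

(** Moving A, then B, from one side of <x, y> to the other gives
    c.1 <x, y> = d.2^* <x, y> and c.2 <x, y> = d.1^* <x, y>. *)
Lemma common_eigvec_gram_neq0 c d x y :
  common_eigvec c x -> common_eigvec d y -> gram x y != 0 ->
  c.1 = d.2^* /\ c.2 = d.1^*.
Proof.
move=> [xA xB] [yA yB] xy0.
have cancel a b : a *: gram x y = b *: gram x y -> a = b.
  move/eqP; rewrite -subr_eq0 -scalerBl scaler_eq0 (negPf xy0) orbF subr_eq0.
  exact/eqP.
by split; apply: cancel;
  rewrite -gramZl -?xA -?xB ?gram_adjA ?gram_adjB ?yA ?yB gramZr.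
Qed.

(** Collect the terms of x with the same eigenvalues d into y d.  If e <., .> were
    positive at each nonzero y d, no nonzero y d would be isotropic, hence they
    would be mutually orthogonal, and e <x, x> would be the sum of the values
    e <y d, y d>, which is positive. *)
Lemma common_eigvec_nonpos (I : finType) (c : I -> C * C) (w : I -> 'rV_n)
    (e : C) (x := \sum_i w i) :
    e^* = - e -> (forall i, common_eigvec (c i) (w i)) ->
    x != 0 -> e * gram x x 0 0 <= 0 ->
  exists d (y := \sum_(i | c i == d) w i),
    [/\ common_eigvec d y, y != 0 & e * gram y y 0 0 <= 0].
Proof.
move=> eC cw x0 qx.
pose y d := \sum_(i | c i == d) w i; pose q (z : 'rV_n) := e * gram z z 0 0.
have cy d : common_eigvec d (y d).
  by apply: common_eigvec_sum => i /eqP <-.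
pose s := undup [seq c i | i <- enum I].
case: (boolP (has (fun d => (y d != 0) && (q (y d) <= 0)) s)).
  by case/hasP=> d _ /andP[]; exists d.
move/hasPn=> s_pos; exfalso; move: x0; apply/negP; rewrite negbK.
have q_real z : q z \is Num.real.
  by apply/CrealP; rewrite rmorphM /= eC (gram_diag_conj H_skew) mulrNN.
have y_pos d : d \in s -> y d != 0 -> 0 < q (y d).
  by move=> /s_pos; rewrite negb_and => /orP[/negPf->//|]; rewrite -real_ltNge.
have y_ortho d d' : d \in s -> d' \in s -> d != d' -> gram (y d) (y d') = 0.
  move=> ds d's dd'; apply: contra_neq_eq dd' => yy.
  have self f : f \in s -> y f != 0 -> f.2 = f.1^*.
    move=> fs /(y_pos _ fs) qf.
    apply: (proj2 (common_eigvec_gram_neq0 (cy f) (cy f) _)).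
    by apply: contraTneq qf => yf; rewrite /q yf mxE mulr0 ltxx.
  have y0 : y d != 0 by apply: contraNneq yy => ->; rewrite gram0l.
  have y'0 : y d' != 0.
    by apply: contraNneq yy => ->; rewrite gram0r.
  have [E1 E2] := common_eigvec_gram_neq0 (cy d) (cy d') yy.
  rewrite [d]surjective_pairing [d']surjective_pairing E1 E2.
  by rewrite (self d') // conjCK.
have xE : x = \sum_(d <- s) y d.
  rewrite (exchange_big_dep xpredT) //=; apply: eq_bigr => i _.
  have ci_s : c i \in s by rewrite mem_undup map_f ?mem_enum.
  rewrite big_mkcond (bigD1_seq (c i)) ?undup_uniq //= eqxx.
  by rewrite big1 ?addr0 // => d; rewrite eq_sym => /negPf->.
have y_ge0 d : d \in s -> 0 <= q (y d).
  move=> ds; have [->|/(y_pos _ ds)/ltW//] := eqVneq (y d) 0.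
  by rewrite /q gram0l mxE mulr0.
have qE : q x = \sum_(d <- s | d \in s) q (y d).
  rewrite -big_seq /q {1}xE gram_suml summxE mulr_sumr [LHS]big_seq [RHS]big_seq.
  apply: eq_bigr => d ds; rewrite xE gram_sumr (bigD1_seq d) ?undup_uniq //=.
  rewrite big_seq_cond big1 ?addr0 // => d' /andP[d's d'd].
  by rewrite y_ortho // eq_sym.
have: q x == 0 by rewrite eq_le qx qE sumr_ge0.
rewrite qE psumr_eq0 // => /allP q0.
rewrite xE big_seq big1 // => d ds; apply/eqP; apply: contraTT (q0 d ds) => yd0.
by rewrite ds /= gt_eqF ?y_pos.
Qed.

End CommonEigenvectors.

(** * Projection onto the orthogonal complement *)

Section Projection.
Variables (C : numClosedFieldType) (n : nat) (H : 'M[C]_n).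
Local Notation gram := (gram H).

(** Applied on the right of row vectors, the projection onto the vectors x with
    gram x P = 0 along the row space of P, provided gram P P is invertible. *)
Definition orth_proj p (P : 'M[C]_(p, n)) : 'M_n :=
  1%:M - H *m P ^t* *m invmx (gram P P) *m P.

Variables (p : nat) (P : 'M[C]_(p, n)).
Hypothesis P_nondeg : gram P P \in unitmx.

Lemma mul_orth_proj q (X : 'M_(q, n)) :
  X *m orth_proj P = X - gram X P *m invmx (gram P P) *m P.
Proof. by rewrite mulmxBr mulmx1 !mulmxA. Qed.

Lemma orth_proj_gram q (X : 'M_(q, n)) : gram (X *m orth_proj P) P = 0.
Proof.
by rewrite mul_orth_proj gramDl -mulNmx gramMl mulNmx mulmxKV ?subrr.
Qed.

Lemma orth_proj_id q (X : 'M_(q, n)) : gram X P = 0 -> X *m orth_proj P = X.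
Proof. by rewrite mul_orth_proj => ->; rewrite !mul0mx subr0. Qed.

Lemma gram_orth_proj q r (X : 'M_(q, n)) (Y : 'M_(r, n)) :
  gram X P = 0 -> gram X (Y *m orth_proj P) = gram X Y.
Proof.
by move=> XP; rewrite mul_orth_proj gramDr -mulNmx gramMr XP mul0mx addr0.
Qed.

(** Stability of the row space of P under B makes its orthogonal complement stable
    under the adjoint A, so A preserves the image and the kernel of the
    projection. *)
Lemma orth_proj_comm (A B : 'M_n) :
  A *m H = H *m B ^t* -> stablemx P A -> stablemx P B ->
  orth_proj P *m A = A *m orth_proj P.
Proof.
move=> adjAB /submxP[D PA] /submxP[E PB].
have DE : D *m gram P P = gram P P *m E ^t*.
  by rewrite -gramMl -PA (gram_adjA adjAB) PB gramMr.
rewrite mulmxBl mulmxBr mul1mx mulmx1 -(mulmxA _ P A) PA !mulmxA adjAB.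
rewrite -(mulmxA H (B ^t*)) -ctr_mul PB ctr_mul !mulmxA; congr (_ - _ *m _).
rewrite -!mulmxA; congr (_ *m (_ *m _)).
by apply: (can_inj (mulKmx P_nondeg)); rewrite mulKVmx // mulmxA -DE mulmxK.
Qed.

End Projection.

(** * Common eigenvectors in an orthogonal complement *)

Section ComplementEigenvectors.
Variables (C : numClosedFieldType) (n : nat) (H A B : 'M[C]_n).
Hypothesis H_skew : H ^t* = - H.
Hypothesis H_unit : H \in unitmx.
Hypothesis adjAB : A *m H = H *m B ^t*.
Variable Q : 'M[C]_n.
Variable c : 'I_n -> C * C.
Hypothesis Q_unit : Q \in unitmx.
Hypothesis cQ : forall j, common_eigvec A B (c j) (row j Q).
Local Notation gram := (gram H).
Local Notation common_eigvec := (common_eigvec A B).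
Local Notation orth_proj := (orth_proj H).

Section Complement.
Variables (p : nat) (P : 'M[C]_(p, n)).
Hypothesis P_nondeg : gram P P \in unitmx.
Hypothesis PA : stablemx P A.
Hypothesis PB : stablemx P B.

Lemma orth_proj_eigvec f x :
  common_eigvec f x -> common_eigvec f (x *m orth_proj P).
Proof.
move=> [xA xB].
have adjBA : B *m H = H *m A ^t*.
  have := congr1 (fun X => - X ^t*) adjAB.
  by rewrite !ctr_mul trmxCK H_skew mulNmx mulmxN !opprK.
split; rewrite -mulmxA.
  by rewrite (orth_proj_comm _ adjAB) // mulmxA xA scalemxAl.
by rewrite (orth_proj_comm _ adjBA) // mulmxA xB scalemxAl.
Qed.

Lemma orth_eigvec_nonpos (e : C) (w : 'rV_n) : e^* = - e ->
    w != 0 -> gram w P = 0 -> e * gram w w 0 0 <= 0 ->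
  exists d y, [/\ common_eigvec d y, y != 0, gram y P = 0
                & e * gram y y 0 0 <= 0].
Proof.
move=> eC w0 wP qw.
pose v j := (w *m invmx Q) 0 j *: (row j Q *m orth_proj P).
have wE : w = \sum_j v j.
  rewrite -[LHS](orth_proj_id wP) -{1}[w](mulmxKV Q_unit).
  rewrite (mulmx_sum_row _ Q) mulmx_suml; apply: eq_bigr => j _.
  by rewrite -scalemxAl.
have cv j : common_eigvec (c j) (v j).
  by apply/common_eigvecZ/orth_proj_eigvec.
rewrite wE in w0 qw.
have [d [dy y0 qy]] := common_eigvec_nonpos H_skew adjAB eC cv w0 qw.
exists d; eexists; split; [exact: dy | exact: y0 | | exact: qy].
rewrite gram_suml big1 // => j _.
by rewrite gramZl orth_proj_gram ?scaler0.
Qed.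

(** By nondegeneracy some vector of the eigenbasis is not orthogonal to x, and
    projecting it does not change its product with x. *)
Lemma orth_eigvec_partner (x : 'rV_n) : x != 0 -> gram x P = 0 ->
  exists d z, [/\ common_eigvec d z, gram z P = 0 & gram x z != 0].
Proof.
move=> x0 xP; have /rV0Pn[j xj] : gram x Q != 0.
  rewrite gramE -mulmxA mulmx_free_eq0 // row_free_unit unitmx_mul.
  by rewrite H_unit ctr_unit.
exists (c j), (row j Q *m orth_proj P); split.
- exact: orth_proj_eigvec.
- exact: orth_proj_gram.
rewrite gram_orth_proj //; apply: contraNneq xj => xz.
have := row_gram H x Q 0 j; rewrite row_id xz => /matrixP/(_ 0 0).
by rewrite !mxE mulr1n => /esym/eqP.
Qed.

End Complement.

(** The positive number is the determinant of the Gram matrix of w and z; M is the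
    change of basis that makes their plane hyperbolic. *)
Lemma eigvec_hyperbolic_pair d d' (w z : 'rV_n) :
    common_eigvec d w -> common_eigvec d' z ->
    0 < gram w w 0 0 * gram z z 0 0 + gram w z 0 0 * (gram w z 0 0)^* ->
  exists M : 'M_(1 + 1), let E := M *m col_mx w z in
    [/\ hyperbolic_frame H (usubmx E) (dsubmx E), stablemx E A & stablemx E B].
Proof.
move=> [wA wB] [zA zB] det_gt0.
have [M MG] := plane_gram_hyperbolic (gram_diag_conj H_skew w)
  (gram_diag_conj H_skew z) det_gt0.
have M_unit : M \in unitmx.
  have : M *m (plane_gram (gram w w 0 0) (gram z z 0 0) (gram w z 0 0) *m M ^t*)
      \in unitmx by rewrite mulmxA MG Jmx_unit.
  by rewrite unitmx_mul => /andP[].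
have stable X a b : w *m X = a *: w -> z *m X = b *: z ->
    stablemx (M *m col_mx w z) X.
  move=> wX zX; have M_full : row_full M by rewrite row_full_unit.
  rewrite -mulmxA !(eqmxMfull _ M_full) mul_col_mx wX zX col_mx_sub.
  have /andP[sw sz] : (w <= col_mx w z)%MS && (z <= col_mx w z)%MS.
    by rewrite -col_mx_sub.
  by rewrite !scalemx_sub.
exists M; split; [| exact: stable wA zA | exact: stable wB zB].
set E := M *m col_mx w z; have EE : gram E E = Jmx 1.
  rewrite gramMl gramMr mulmxA -MG gram_col_mx; congr (_ *m _ *m _).
  rewrite (gramC H_skew z w) /plane_gram; congr block_mx;
  by apply/rowP=> i; rewrite !ord1 !mxE ?mulr1n.
move: EE; rewrite -{1 2}[E]vsubmxK gram_col_mx => /eq_block_mx[uu uv vu vv].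
by split.
Qed.

End ComplementEigenvectors.

(** * Frames adapted to the two operators *)

Section Adapted.
Variables (C : numClosedFieldType) (n : nat) (H A B : 'M[C]_n).
Hypothesis H_skew : H ^t* = - H.
Hypothesis H_unit : H \in unitmx.
Hypothesis adjAB : A *m H = H *m B ^t*.
Variables (Q : 'M[C]_n) (c : 'I_n -> C * C).
Hypothesis Q_unit : Q \in unitmx.
Hypothesis cQ : forall j, common_eigvec A B (c j) (row j Q).
Local Notation gram := (gram H).

Definition adapted_frame k (U V : 'M[C]_(k, n)) :=
  [/\ hyperbolic_frame H U V,
      forall i, stablemx (frame_plane U V i) A
    & forall i, stablemx (frame_plane U V i) B].

(** The orthogonal complement of the frame contains common eigenvectors y and z
    with 'i <y, y> <= 0 and - 'i <z, z> <= 0.  The new plane is spanned by both if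
    neither is isotropic, and otherwise by an isotropic one and a partner. *)
Lemma adapted_frame_extend m (L : 'M_(m, n)) k (U V : 'M_(k, n)) :
    row_free L -> gram L L = 0 -> (k < m)%N -> adapted_frame U V ->
  exists U' V' : 'M_(k.+1, n), adapted_frame U' V'.
Proof.
move=> L_free LL km [UV stA stB].
pose P := col_mx U V.
have PA : stablemx P A := frame_plane_stable stA.
have PB : stablemx P B := frame_plane_stable stB.
have P_nd : gram P P \in unitmx.
  by rewrite (hyperbolic_frame_gram H_skew UV) Jmx_unit.
pose q (x : 'rV_n) : C := gram x x 0 0.
have qC x : (q x)^* = - q x := gram_diag_conj H_skew x.
have nonpos e : e^* = - e -> e ^+ 2 = -1 -> exists d y,
    [/\ common_eigvec A B d y, y != 0, gram y P = 0 & e * q y <= 0].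
  move=> eC ee.
  have [w w0 [wP qw]] := isotropic_nonpos H_skew L_free LL UV km eC ee.
  exact: (orth_eigvec_nonpos H_skew adjAB Q_unit cQ P_nd PA PB eC w0 wP qw).
pose indefinite_pair := exists d d' w z,
    [/\ common_eigvec A B d w, common_eigvec A B d' z, gram w P = 0, gram z P = 0
      & 0 < q w * q z + gram w z 0 0 * (gram w z 0 0)^*].
suff [d [d' [w [z [dw dz wP zP det_gt0]]]]] : indefinite_pair.
  have [M [E_frame EA EB]] := eigvec_hyperbolic_pair H_skew dw dz det_gt0.
  set E := M *m _ in E_frame EA EB.
  have EP : gram E P = 0 by rewrite gramMl gram_col_mxl wP zP col_mx0 mulmx0.
  exists (col_mx (usubmx E) U), (col_mx (dsubmx E) V); split.
  - by apply: (hyperbolic_frame_cat H_skew E_frame UV); rewrite vsubmxK.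
  - apply: (@frame_plane_cat _ n 1 k) => // i.
    by rewrite /frame_plane !ord1 !row_id vsubmxK.
  - apply: (@frame_plane_cat _ n 1 k) => // i.
    by rewrite /frame_plane !ord1 !row_id vsubmxK.
have isotropic d x : common_eigvec A B d x -> x != 0 -> gram x P = 0 -> q x = 0 ->
    indefinite_pair.
  move=> dx x0 xP qx.
  have [d' [z [dz zP xz]]] :=
    orth_eigvec_partner H_skew H_unit adjAB Q_unit cQ P_nd PA PB x0 xP.
  exists d, d', x, z; split=> //; rewrite qx mul0r add0r mul_conjC_gt0.
  apply: contraNneq xz => xz; apply/eqP/rowP=> i.
  by rewrite !ord1 xz mxE.
have iC : 'i^* = - 'i :> C := conjCi C.
have [d [y [dy y0 yP qy]]] := nonpos 'i iC (sqrCi C).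
have [|d' [z [dz z0 zP qz]]] := nonpos (- 'i) _ (etrans (sqrrN _) (sqrCi C)).
  by rewrite rmorphN /= iC.
have [qy0|qy0] := eqVneq (q y) 0; first exact: (isotropic d y).
have [qz0|qz0] := eqVneq (q z) 0; first exact: (isotropic d' z).
exists d, d', y, z; split=> //.
apply: ltr_pwDl; last exact: mul_conjC_ge0.
(* ('i <y, y>) (- 'i <z, z>) is a product of two negative numbers. *)
have -> : q y * q z = ('i * q y) * (- 'i * q z).
  by rewrite mulrACA mulrN -expr2 sqrCi opprK mul1r.
have i0 : 'i != 0 :> C := neq0Ci C.
by rewrite nmulr_rgt0 lt_neqAle ?qy ?qz mulf_neq0 ?oppr_eq0.
Qed.

Lemma adapted_frame_exists m (L : 'M_(m, n)) :
    row_free L -> gram L L = 0 ->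
  exists U V : 'M_(m, n), adapted_frame U V.
Proof.
move=> L_free LL.
suff: forall k, (k <= m)%N -> exists U V : 'M_(k, n), adapted_frame U V by apply.
elim=> [_|k IHk km].
  exists 0, 0; split; [by split; apply/matrixP; case | by case | by case].
have [U [V UV]] := IHk (ltnW km).
exact: adapted_frame_extend L_free LL km UV.
Qed.

End Adapted.

(** * Four-diagonal form of diagonalizable normal matrices *)

Lemma diagonalizable_diagP (F : fieldType) n (A : 'M[F]_n) :
  diagonalizable A <-> exists Q d, Q \in unitmx /\ Q *m A = diag_mx d *m Q.
Proof.
split=> [[Q Q_unit /diag_mxP[d Qd]]|[Q [d [Q_unit QA]]]].
  by exists Q, d; split=> //; apply/(similarP Q_unit)/eqP.
exists Q => //; apply/diag_mxP; exists d; apply/eqP.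
exact/(similarP Q_unit).
Qed.

Lemma diagonalizable_ctr (C : numClosedFieldType) n (A : 'M[C]_n) :
  diagonalizable A -> diagonalizable (A ^t*).
Proof.
move=> /diagonalizable_diagP[Q [d [Q_unit QA]]]; apply/diagonalizable_diagP.
exists (invmx (Q ^t*)), (map_mx Num.conj d); rewrite unitmx_inv ctr_unit.
split=> //.
rewrite -ctr_diag (_ : A = invmx Q *m diag_mx d *m Q); last first.
  by rewrite -mulmxA -QA mulKmx.
by rewrite !ctr_mul ctr_inv !mulmxA mulVmx ?mul1mx // ctr_unit.
Qed.

Lemma diagonalizable_similar (F : fieldType) n (P A : 'M[F]_n) :
  P \in unitmx -> diagonalizable A -> diagonalizable (invmx P *m A *m P).
Proof.
move=> P_unit /diagonalizable_diagP[Q [d [Q_unit QA]]]; apply/diagonalizable_diagP.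
exists (Q *m P), d; rewrite unitmx_mul Q_unit; split=> //.
by rewrite !mulmxA mulmxK // QA.
Qed.

Lemma common_eigenbasis (C : numClosedFieldType) n (A B : 'M[C]_n) :
    A *m B = B *m A -> diagonalizable A -> diagonalizable B ->
  exists2 Q, Q \in unitmx &
    exists c : 'I_n -> C * C, forall j, common_eigvec A B (c j) (row j Q).
Proof.
move=> AB dA dB.
have [|Q Q_unit /and3P[QA QB _]] := (codiagonalizableP [:: A; B]).1.
  by split=> [X Y|X]; rewrite !inE => /orP[]/eqP->; [move=> /orP[]/eqP->..| |].
have {QA} /diag_mxP[a /eqP/(similarP Q_unit)QA] := QA.
have {QB} /diag_mxP[b /eqP/(similarP Q_unit)QB] := QB.
exists Q => //; exists (fun j => (a 0 j, b 0 j)) => j.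
by split; rewrite -row_mul ?QA ?QB row_mul row_diag_mx -scalemxAl -rowE.
Qed.

Lemma Jmx_skew (C : numClosedFieldType) m :
  (Jmx m : 'M[C]_(m + m)) ^t* = - Jmx m.
Proof.
rewrite /Jmx tr_block_mx map_block_mx opp_block_mx !trmx0 !map_mx0 oppr0 opprK.
by rewrite trmx1 map_mx1 ctrN trmx1 map_mx1.
Qed.

Lemma Jmx_inv (C : numClosedFieldType) m :
  invmx (Jmx m) = - Jmx m :> 'M[C]_(m + m).
Proof.
apply: (can_inj (mulKmx (Jmx_unit C m))); rewrite mulmxV ?Jmx_unit //.
rewrite mulmxN /Jmx mulmx_block !mul0mx !mulmx0 !mul1mx !mulmx1.
by rewrite !add0r !addr0 opp_block_mx !opprK !oppr0 -scalar_mx_block.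
Qed.

Lemma is_diag_ctr (C : numClosedFieldType) m (X : 'M[C]_m) :
  is_diag_mx X -> is_diag_mx (X ^t*).
Proof. by move=> /diag_mxP[d ->]; rewrite ctr_diag diag_mx_is_diag. Qed.

Lemma is_diagN (V : zmodType) m (X : 'M[V]_m) :
  is_diag_mx X -> is_diag_mx (- X).
Proof. by move=> /diag_mxP[d ->]; rewrite -raddfN diag_mx_is_diag. Qed.

(** The rows u_i, v_i of an adapted frame P for A^H form the adjoint of S.  The
    matrix of A^H in this frame is gram (P *m A^H) P *m J^-1, and multiplying by
    J^-1 only permutes the blocks of the Gram matrix up to sign, so it suffices
    that these blocks are diagonal. *)
Theorem Jnormal_four_diagonal (C : numClosedFieldType) (m : nat)
    (A : 'M[C]_(m + m)) :
  Jnormal A -> diagonalizable A ->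
  exists S : 'M[C]_(m + m),
    [/\ S \in unitmx, symplectic S & four_diagonal_form (invmx S *m A *m S)].
Proof.
move=> A_normal A_diag.
have J_unit : Jmx m \in unitmx := Jmx_unit C m.
have J_skew := Jmx_skew C m.
pose A' := A ^t*; pose B' := (Jstar A) ^t*.
have adj : A' *m Jmx m = Jmx m *m B' ^t*.
  by rewrite trmxCK /Jstar !mulmxA mulmxV // mul1mx.
have comm : A' *m B' = B' *m A' by rewrite -!ctr_mul A_normal.
have [Q Q_unit [c cQ]] := common_eigenbasis comm (diagonalizable_ctr A_diag)
  (diagonalizable_ctr (diagonalizable_similar J_unit (diagonalizable_ctr A_diag))).
(* The first m coordinate vectors span an isotropic subspace. *)
pose L : 'M[C]_(m, m + m) := row_mx 1%:M 0.
have L_free : row_free L.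
  apply/row_freeP; exists (col_mx 1%:M 0).
  by rewrite mul_row_col mulmx1 mul0mx addr0.
have LL : gram (Jmx m) L L = 0.
  rewrite /gram mul_row_block tr_row_mx map_col_mx mul_row_col.
  by rewrite !mul1mx !mul0mx addr0 mul0mx trmx0 map_mx0 mulmx0 addr0.
have [U [V [UV stA stB]]] :=
  adapted_frame_exists J_skew J_unit adj Q_unit cQ L_free LL.
pose P := col_mx U V.
have PP : gram (Jmx m) P P = Jmx m := hyperbolic_frame_gram J_skew UV.
have P_unit : P \in unitmx.
  have : P *m (Jmx m *m P ^t*) \in unitmx by rewrite mulmxA -/(gram _ P P) PP.
  by rewrite unitmx_mul => /andP[].
exists (P ^t*); split; first by rewrite ctr_unit.
  by rewrite /symplectic trmxCK.
have -> : invmx (P ^t*) *m A *m P ^t* = (P *m A' *m invmx P) ^t*.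
  by rewrite !ctr_mul ctr_inv trmxCK mulmxA.
have -> : P *m A' *m invmx P = gram (Jmx m) (P *m A') P *m - Jmx m.
  rewrite -Jmx_inv; apply: (can_inj (mulmxK J_unit)); rewrite mulmxKV //.
  rewrite /gram -!mulmxA; congr (P *m (A' *m _)).
  by apply: (can_inj (mulKmx P_unit)); rewrite mulKVmx // mulmxA -[LHS]PP.
have [UU1 UV1 VV1] := UV.
have VU1 : gram (Jmx m) V U = - 1%:M.
  by rewrite (gramC J_skew) UV1 trmx1 map_mx1.
have [UAU VAU] : is_diag_mx (gram (Jmx m) (U *m A') U) /\
    is_diag_mx (gram (Jmx m) (V *m A') U).
  apply: frame_plane_diag => //; first by rewrite UU1 mx0_is_diag.
  by rewrite VU1 -raddfN scalar_mx_is_diag.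
have [UAV VAV] : is_diag_mx (gram (Jmx m) (U *m A') V) /\
    is_diag_mx (gram (Jmx m) (V *m A') V).
  apply: frame_plane_diag => //; last by rewrite VV1 mx0_is_diag.
  by rewrite UV1 scalar_mx_is_diag.
rewrite mul_col_mx gram_col_mx /Jmx opp_block_mx opprK !oppr0 mulmx_block.
rewrite !mulmx0 !mulmx1 !mulmxN !mulmx1 !addr0 !add0r tr_block_mx map_block_mx.
do 4!eexists; split; last reflexivity.
by split; apply: is_diag_ctr => //; apply: is_diagN.
Qed.

Theorem theorem8 (R : realType) (m : nat) (A : 'M[R[i]]_(m + m)) :
  Jnormal A -> diagonalizable A ->
  exists S : 'M[R[i]]_(m + m),
    [/\ S \in unitmx, symplectic S & four_diagonal_form (invmx S *m A *m S)].
Proof. exact: Jnormal_four_diagonal. Qed.
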